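(* Let $N \in \mathbb{N}$ and $0<\beta<1/(N+1)$, and let $\Gamma$ be the attractor of the self-similar IFS $\{\phi_i(x)=\beta x+i\frac{1-\beta}{N}: i=0,1,\ldots,N\}$. Let $m\in\mathbb{N}$ and let $\boldsymbol{t}=(t_0,t_1,\ldots,t_m)\in\mathbb{R}^{m+1}$ with $0=t_0<t_1<\cdots<t_m$. Then the union $\Gamma_{\boldsymbol{t}}=\bigcup_{j=0}^m(\Gamma+t_j)$ is a self-similar set if and only if either $\boldsymbol{t}$ or its conjugate $\widehat{\boldsymbol{t}}$ is an admissible translation vector.
   Context: $\mathbb{N}=\{1,2,\ldots\}$. A self-similar IFS on $\mathbb{R}$ is a finite set of maps $f_i(x)=\lambda_i x+a_i$ with $0<|\lambda_i|<1$, $a_i\in\mathbb{R}$; its attractor is the unique non-empty compact set $K\subset\mathbb{R}$ with $K=\bigcup_i f_i(K)$. A self-similar set is the attractor of some self-similar IFS; self-similar sets are always assumed to be non-singletons. Let $\Omega=\{0,1,\ldots,N\}$. For a word $\mathbf{i}=i_1i_2\ldots i_n\in\Omega^n$ put $\phi_{\mathbf{i}}=\phi_{i_1}\circ\phi_{i_2}\circ\cdots\circ\phi_{i_n}$. For $n\in\mathbb{N}$ let $E_n=\{\phi_{\mathbf{i}}(0):\mathbf{i}\in\Omega^n\}$ and $T_n=\beta^{-n}E_n$ (the sequence $T_n$ is increasing), and let $T=\bigcup_{n=1}^\infty T_n$. For $\boldsymbol{t}=(t_0,\ldots,t_m)\in T^{m+1}$ with $0=t_0<t_1<\cdots<t_m$,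 let $\tau_{\boldsymbol{t}}\in\mathbb{N}$ be the smallest integer such that $t_1,\ldots,t_m\in T_{\tau_{\boldsymbol{t}}}$, and for $n\ge\tau_{\boldsymbol{t}}$ let $$\Omega_{\boldsymbol{t}}^n=\{\mathbf{i}\in\Omega^n:\phi_{\mathbf{i}}(t_j)\in E_n\ \forall 1\le j\le m\},\qquad \widehat{\Omega}_{\boldsymbol{t}}^n=\{\mathbf{i}\in\Omega^n:\phi_{\mathbf{i}}(-t_j)\in E_n\ \forall 1\le j\le m\}.$$ Admissible translation vector: a vector $\boldsymbol{t}=(t_0,\ldots,t_m)\in\mathbb{R}^{m+1}$ with $0=t_0<t_1<\cdots<t_m$ is admissible if $\boldsymbol{t}\in T^{m+1}$ and there exist two finite sets $\mathcal{I}_1\subset\bigcup_{n=\tau_{\boldsymbol{t}}}^\infty\Omega_{\boldsymbol{t}}^n$ and $\mathcal{I}_2\subset\bigcup_{n=\tau_{\boldsymbol{t}}}^\infty\widehat{\Omega}_{\boldsymbol{t}}^n$ such that $$\bigcup_{\mathbf{i}\in\mathcal{I}_1}\phi_{\mathbf{i}}(\Gamma_{\boldsymbol{t}})\cup\bigcup_{\mathbf{i}\in\mathcal{I}_2}\phi_{\mathbf{i}}(1-\Gamma_{\boldsymbol{t}})=\Gamma,$$ where $1-A=\{1-x:x\in A\}$. Conjugate: $\widehat{\boldsymbol{t}}=(\widehat t_0,\ldots,\widehat t_m)$ with $\widehat t_j=t_m-t_{m-j}$ for $0\le j\le m$ (so $0=\widehat t_0<\cdots<\widehat t_m$). *)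

(* Defs.v *)
From HB Require Import structures.
From mathcomp Require Import all_boot all_order all_algebra.
From mathcomp Require Import all_classical all_reals all_analysis.

Set Implicit Arguments.
Unset Strict Implicit.
Unset Printing Implicit Defensive.

Import Order.TTheory GRing.Theory Num.Theory.
Import numFieldNormedType.Exports.

Local Open Scope classical_set_scope.
Local Open Scope ring_scope.

(* The pair [p = (lambda, a)] stands for the similarity
   [x |-> lambda * x + a]; a finite set of similarities is given by a list of
   such pairs. *)
Definition simil (R : realType) (p : R * R) (x : R) : R := p.1 * x + p.2.

Definition is_ifs (R : realType) (F : seq (R * R)) : Prop :=
  forall p, p \in F -> 0 < `|p.1| < 1.

(* For [F] satisfying [is_ifs], at most one [K] satisfies this. *)
Definition is_attractor (R : realType) (F : seq (R * R)) (K : set R) : Prop :=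
  [/\ K !=set0, compact K & K = \bigcup_(p in [set` F]) (simil p @` K)].

Definition self_similar (R : realType) (K : set R) : Prop :=
  (exists F : seq (R * R), is_ifs F /\ is_attractor F K) /\
  ~ (exists x : R, K = [set x]).

Section HomogeneousCantor.
Variables (R : realType) (N : nat) (beta : R).

Definition phi_coef (i : 'I_N.+1) : R * R :=
  (beta, i%:R * ((1 - beta) / N%:R)).

Definition phi (i : 'I_N.+1) : R -> R := simil (phi_coef i).

Definition cantor_ifs : seq (R * R) := [seq phi_coef i | i <- enum 'I_N.+1].

(* [phi_word [:: i1; ...; in]] is [phi i1 \o ... \o phi in]. *)
Definition phi_word (w : seq 'I_N.+1) (x : R) : R := foldr phi x w.

Definition words (n : nat) : set (seq 'I_N.+1) := [set w | size w = n].

Definition E_ (n : nat) : set R := [set phi_word w 0 | w in words n].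

Definition T_ (n : nat) : set R := [set beta ^- n * x | x in E_ n].

Definition T : set R := \bigcup_(n in [set n | (1 <= n)%N]) T_ n.

End HomogeneousCantor.

Section TranslationVectors.
Variables (R : realType) (m : nat).
Implicit Type t : 'I_m.+1 -> R.

Definition translation_vector t : Prop :=
  t ord0 = 0 /\ forall i j : 'I_m.+1, (i < j)%N -> t i < t j.

Definition union_translates (Gamma : set R) t : set R :=
  \bigcup_(j : 'I_m.+1) [set x + t j | x in Gamma].

(* [rev_ord j] has value [m - j]. *)
Definition conjugate t : 'I_m.+1 -> R :=
  fun j => t ord_max - t (rev_ord j).

Variables (N : nat) (beta : R).

Definition in_T_level t (n : nat) : Prop :=
  (1 <= n)%N /\ forall j : 'I_m.+1, (1 <= j)%N -> T_ N beta n (t j).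

(* The least [n >= 1] such that all [t j], [j >= 1], lie in [T_ n]. The default
   value [0] is only taken when there is no such [n], that is, when some [t j]
   is not in [T]. *)
Definition tau t : nat :=
  xget 0%N [set n | in_T_level t n /\
                    forall k, in_T_level t k -> (n <= k)%N].

Definition Omega_t t (n : nat) : set (seq 'I_N.+1) :=
  [set w | words n w /\
    forall j : 'I_m.+1, (1 <= j)%N -> E_ N beta n (phi_word beta w (t j))].

Definition Omega_hat_t t (n : nat) : set (seq 'I_N.+1) :=
  [set w | words n w /\
    forall j : 'I_m.+1, (1 <= j)%N -> E_ N beta n (phi_word beta w (- t j))].

Definition admissible (Gamma : set R) t : Prop :=
  [/\ translation_vector t,
      (forall j, T N beta (t j)) &
      exists I1 I2 : set (seq 'I_N.+1),
        [/\ finite_set I1,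
            finite_set I2,
            I1 `<=` \bigcup_(n in [set n | (tau t <= n)%N]) Omega_t t n,
            I2 `<=` \bigcup_(n in [set n | (tau t <= n)%N]) Omega_hat_t t n &
            \bigcup_(w in I1) (phi_word beta w @` union_translates Gamma t) `|`
            \bigcup_(w in I2) (phi_word beta w @`
                               [set 1 - x | x in union_translates Gamma t])
            = Gamma]].

End TranslationVectors.

(* Main.v *)
Require Import Defs.
From HB Require Import structures.
From mathcomp Require Import all_boot all_order all_algebra.
From mathcomp Require Import all_classical all_reals all_analysis.
From mathcomp Require Import ring lra.

Set Implicit Arguments.
Unset Strict Implicit.
Unset Printing Implicit Defensive.

Import Order.TTheory GRing.Theory Num.Theory.
Import numFieldNormedType.Exports.

Local Open Scope classical_set_scope.
Local Open Scope ring_scope.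

(** Write [Gt] for the union of the translates [Gamma + t j].

    The hard direction rests on a rigidity property of [Gamma]: an affine map
    [x |-> l * x + a], [l != 0], that sends [Gamma] into itself is
    [phi_word w] or [phi_word w (1 - _)] for some word [w] ([rigidity]). Indeed
    if [`|l| < 1] the image of [Gamma] lies in a single first-level piece
    [phi i Gamma]: otherwise it would straddle one of the first-level gaps,
    whose preimage would be a gap of [Gamma] longer than any gap of [Gamma]
    ([Gamma_gap]). One then divides out [phi i] and repeats until the ratio
    has absolute value at least 1, where only [x] and [1 - x] are left.

    Suppose that [Gt] is self-similar. Near 0 the set [Gt] coincides with
    [Gamma], because only the translate by [t 0 = 0] reaches there. Iterating
    the given system until its pieces are very small, the pieces of [Gt] that
    meet a small initial copy [beta ^+ k * Gamma] are trapped in it, since a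
    gap of a definite size separates this copy from the rest of [Gamma].
    Blown up by [beta ^- k], they cover [Gamma] exactly by finitely many affine
    images of [Gt], each contained in [Gamma] ([small_copies]). Such an affine
    image contains one of [Gamma], so rigidity identifies it as
    [phi_word w Gt] or [phi_word w (1 - Gt)]; applied to the other translates,
    rigidity also gives the membership conditions on [w]
    ([self_similar_word_cover]). This is the cover that admissibility asks for.

    It remains to see that the [t j] lie in [T]. The point 0 of [Gamma] belongs
    to some member of the cover. If this is a copy [phi_word w Gt], then
    [phi_word w 0 = 0] and every [t j] is in [T]; if it is a reflected copy,
    then the largest translation is sent to 0 and it is the conjugate vector
    whose entries are in [T] ([word_cover_T]). Since the union attached to the
    conjugate vector is a reflection of [Gt], it is self-similar as well, and
    in both cases one of the two vectors is admissible.

    Conversely an admissible cover of [Gamma], translated by each [t j], writes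
    [Gt] as a finite union of similar copies of itself. *)

(** * Compact sets and similarities of the line *)

Section RealLine.
Variable R : realType.

Lemma expr_lt_eps (r e : R) : 0 <= r < 1 -> 0 < e -> exists n, r ^+ n < e.
Proof.
move=> /andP[r0 r1] e0.
have h : r ^+ n @[n --> \oo] --> (0 : R) by apply: cvg_expr; rewrite ger0_norm.
have /cvgrPdist_lt /(_ _ e0) [n _ hn] := h.
exists n; have := hn n (leqnn n).
by rewrite /= sub0r normrN ger0_norm ?exprn_ge0.
Qed.

Lemma compact_approx (A : set R) (x : R) : compact A ->
  (forall e, 0 < e -> exists2 y, A y & `|x - y| < e) -> A x.
Proof.
move=> cA h; have clA := compact_closed (@Rhausdorff R) cA.
apply: clA => B /nbhs_ballP[e /= e0 eB].
have [y Ay xy] := h e e0; exists y; split; first exact: Ay.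
exact: (eB y xy).
Qed.

Lemma compact_max (A : set R) : A !=set0 -> compact A ->
  exists2 c, A c & forall x, A x -> x <= c.
Proof.
move=> A0 cA.
have idc : {within A, continuous (@idfun R)}.
  by apply: continuous_subspaceT => x; exact: cvg_id.
have [c] := compact_EVT_max A0 cA idc.
by rewrite inE => Ac h; exists c => // x Ax; apply: h; rewrite inE.
Qed.

Lemma compact_min (A : set R) : A !=set0 -> compact A ->
  exists2 c, A c & forall x, A x -> c <= x.
Proof.
move=> A0 cA.
have idc : {within A, continuous (@idfun R)}.
  by apply: continuous_subspaceT => x; exact: cvg_id.
have [c] := compact_EVT_min A0 cA idc.
by rewrite inE => Ac h; exists c => // x Ax; apply: h; rewrite inE.
Qed.

Lemma simil_continuous (p : R * R) : continuous (simil p).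
Proof.
by move=> x; apply: cvgD; [apply: cvgM; [exact: cvg_cst|exact: cvg_id]|exact: cvg_cst].
Qed.

Lemma compact_simil (p : R * R) (A : set R) :
  compact A -> compact (simil p @` A).
Proof.
move=> cA; apply: continuous_compact => //; apply: continuous_subspaceT.
exact: simil_continuous.
Qed.

End RealLine.

(** * Iterating a self-similar system *)

Section IteratedSystem.
Variable R : realType.
Implicit Types (F : seq (R * R)) (K : set R) (p q : R * R).

Definition simil_comp p q : R * R := (p.1 * q.1, p.1 * q.2 + p.2).

Lemma simil_compE p q x : simil (simil_comp p q) x = simil p (simil q x).
Proof. by rewrite /simil /=; ring. Qed.

Lemma ifs_ratio_bound F : is_ifs F ->
  exists2 r, 0 <= r < 1 & forall p, p \in F -> `|p.1| <= r.
Proof.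
elim: F => [|p F IH] hF; first by exists 0; rewrite ?lexx ?ltr01.
have [|r /andP[r0 r1] hr] := IH; first by move=> q qF; apply: hF; rewrite inE qF orbT.
have /andP[p0 p1] : 0 < `|p.1| < 1 by apply: hF; rewrite inE eqxx.
exists (Num.max `|p.1| r); first by rewrite le_max gt_max r0 p1 r1 orbT.
move=> q; rewrite inE le_max => /orP[/eqP->|/hr ->]; first by rewrite lexx.
by rewrite orbT.
Qed.

(** The compositions of [n] maps of the system cover [K] as well, with ratios
    at most [r ^+ n]. *)
Lemma fine_pieces F K (e : R) : is_ifs F -> is_attractor F K -> 0 < e ->
  exists G : seq (R * R), (forall p, p \in G -> 0 < `|p.1| < e) /\
    K = \bigcup_(p in [set` G]) (simil p @` K).
Proof.
move=> hF [_ _ hK] e0; have [r r01 hr] := ifs_ratio_bound hF.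
have [n hn] := expr_lt_eps r01 e0.
suff [G [hG EG]] : exists G : seq (R * R),
    (forall p, p \in G -> 0 < `|p.1| <= r ^+ n) /\
    K = \bigcup_(p in [set` G]) (simil p @` K).
  by exists G; split=> // p /hG/andP[-> /le_lt_trans ->].
move: hn => _; elim: n => [|n [G [hG EG]]].
  exists [:: (1, 0)]; split.
    by move=> p; rewrite inE => /eqP ->; rewrite normr1 expr0 ltr01 lexx.
  apply/seteqP; split => x.
    move=> Kx; exists (1, 0); first by rewrite /= inE.
    by exists x => //; rewrite /simil mul1r addr0.
  by move=> [p /=]; rewrite inE => /eqP -> [y Ky <-]; rewrite /simil mul1r addr0.
exists [seq simil_comp p q | p <- F, q <- G]; split.
  move=> _ /allpairsP[[p q] /= [pF qG ->]]; rewrite normrM exprS.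
  have /andP[p0 _] := hF p pF; have /andP[q0 q1] := hG q qG.
  by rewrite mulr_gt0 //= ler_pM ?normr_ge0 // hr.
apply/seteqP; split => x.
  rewrite {1}hK => -[p pF [y Ky <-]]; move: Ky; rewrite {1}EG => -[q qG [z Kz <-]].
  exists (simil_comp p q); first by apply/allpairsP; exists (p, q).
  by exists z; rewrite ?simil_compE.
move=> [_ /allpairsP[[p q] /= [pF qG ->]]] [z Kz <-]; rewrite simil_compE hK.
exists p => //; exists (simil q z) => //.
by rewrite EG; exists q => //; exists z.
Qed.

(** Conjugating a map of ratio [l] by the reflection keeps the ratio [l]. *)
Lemma self_similar_reflect K (s : R) :
  self_similar K -> self_similar [set s - x | x in K].
Proof.
move=> [[F [hF [[k Kk] cK EK]]] nK]; split; last first.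
  move=> [x hx]; apply: nK; exists (s - x); apply/seteqP; split => y /=.
    move=> Ky; have : [set s - x | x in K] (s - y) by exists y.
    by rewrite hx => <-; rewrite subKr.
  have [z Kz E] : [set s - x | x in K] x by rewrite hx.
  by move=> ->; rewrite -E subKr.
exists [seq (p.1, s - p.1 * s - p.2) | p <- F]; split.
  by move=> _ /mapP[p pF ->] /=; have := hF p pF.
split; first by exists (s - k), k.
  suff <- : simil (-1, s) @` K = [set s - x | x in K] by exact: compact_simil.
  by congr image; apply/funext => x; rewrite /simil /= mulN1r addrC.
have conj p x : simil (p.1, s - p.1 * s - p.2) (s - x) = s - simil p x.
  by rewrite /simil /=; ring.
apply/seteqP; split => y0.
  move=> [x Kx <-]; move: Kx; rewrite {1}EK => -[p pF [y Ky <-]].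
  exists (p.1, s - p.1 * s - p.2); last first.
    by exists (s - y); [exists y|exact: conj].
  exact: (map_f (fun p => (p.1, s - p.1 * s - p.2))).
move=> [_ /= /mapP[p pF ->]] [_ [x Kx <-] <-].
rewrite conj; exists (simil p x) => //; rewrite EK; by exists p => //; exists x.
Qed.

End IteratedSystem.

(** * The homogeneous Cantor set *)

(** Distance between the left endpoints of consecutive first-level pieces;
    the first-level gaps have length [step N beta - beta]. *)
Definition step (R : realType) (N : nat) (beta : R) : R := (1 - beta) / N%:R.

Section CantorSet.
Variables (R : realType) (N : nat) (beta : R) (Gamma : set R).
Hypothesis hN : (1 <= N)%N.
Hypothesis hbeta : 0 < beta < 1 / N.+1%:R.
Hypothesis hGamma : is_attractor (cantor_ifs N beta) Gamma.

Local Notation c := (step N beta).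

Lemma N_gt0 : 0 < N%:R :> R.
Proof. by rewrite ltr0n. Qed.

Lemma beta_gt0 : 0 < beta.
Proof. by case/andP: hbeta. Qed.

Lemma mulN_step : N%:R * c = 1 - beta.
Proof. by rewrite /step mulrC divfK // gt_eqF ?N_gt0. Qed.

Lemma beta_lt_step : beta < c.
Proof.
case/andP: hbeta => _; rewrite ltr_pdivlMr ?ltr0n // => h.
rewrite /step ltr_pdivlMr ?N_gt0 //; move: h; rewrite -natr1; lra.
Qed.

Lemma step_gt0 : 0 < c.
Proof. exact: lt_trans beta_gt0 beta_lt_step. Qed.

Lemma step_lt1 : c < 1.
Proof.
have h : c <= N%:R * c by rewrite ler_peMl ?ler1n // ltW // step_gt0.
by move: h; rewrite mulN_step; have := beta_gt0; lra.
Qed.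

Lemma beta_lt1 : beta < 1.
Proof. exact: lt_trans beta_lt_step step_lt1. Qed.

Lemma expb_gt0 n : 0 < beta ^+ n.
Proof. by rewrite exprn_gt0 ?beta_gt0. Qed.

Lemma expb_lt_eps e : 0 < e -> exists n, beta ^+ n < e.
Proof. by apply: expr_lt_eps; rewrite (ltW beta_gt0) beta_lt1. Qed.

Lemma phiE (i : 'I_N.+1) x : phi beta i x = beta * x + i%:R * c.
Proof. by []. Qed.

Lemma phi_wordE (w : seq 'I_N.+1) x :
  phi_word beta w x = beta ^+ size w * x + phi_word beta w 0.
Proof.
elim: w x => [|i w IH] x /=; first by rewrite expr0 mul1r addr0.
by rewrite !phiE IH exprS; ring.
Qed.

Lemma Gamma_phi (i : 'I_N.+1) x : Gamma x -> Gamma (phi beta i x).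
Proof.
case: hGamma => _ _ E Gx; rewrite E; exists (phi_coef beta i).
  by rewrite /= /cantor_ifs map_f // mem_enum.
by exists x.
Qed.

Lemma Gamma_phiP x : Gamma x -> exists i : 'I_N.+1, exists2 y, Gamma y & x = phi beta i y.
Proof.
case: hGamma => _ _ E; rewrite {1}E => -[p /= /mapP[i _ ->]] [y Gy <-].
by exists i, y.
Qed.

Lemma Gamma_phi_word (w : seq 'I_N.+1) x : Gamma x -> Gamma (phi_word beta w x).
Proof. by move=> Gx; elim: w => //= i w; apply: Gamma_phi. Qed.

Lemma Gamma_scale n x : Gamma x -> Gamma (beta ^+ n * x).
Proof.
move=> Gx; elim: n => [|n IH]; first by rewrite expr0 mul1r.
have := Gamma_phi (ord0 : 'I_N.+1) IH.
by rewrite phiE mul0r addr0 mulrA -exprS.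
Qed.

Lemma Gamma_nonempty : Gamma !=set0. Proof. by case: hGamma. Qed.
Lemma Gamma_compact : compact Gamma. Proof. by case: hGamma. Qed.

Lemma ord_step_le (i : 'I_N.+1) : 0 <= i%:R * c <= 1 - beta.
Proof.
rewrite mulr_ge0 ?ler0n ?(ltW step_gt0) //= -mulN_step ler_pM2r ?step_gt0 //.
by rewrite ler_nat -ltnS ltn_ord.
Qed.

(** The maximum [s] of [Gamma] is attained by compactness. Its image under the
    map that fixes 1 is in [Gamma], which gives [1 <= s]; and [s] lies in some
    piece [phi i Gamma], so [s <= beta * s + 1 - beta], which gives [s <= 1].
    The minimum is symmetric. *)
Lemma Gamma_01 : [/\ Gamma 0, Gamma 1 & forall x, Gamma x -> 0 <= x <= 1].
Proof.
have b0 := beta_gt0; have b1 := beta_lt1.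
have [s Gs hs] := compact_max Gamma_nonempty Gamma_compact.
have [l Gl hl] := compact_min Gamma_nonempty Gamma_compact.
have l0 : l = 0.
  apply/le_anti/andP; split.
    by have := hl _ (Gamma_phi ord0 Gl); rewrite phiE mul0r; nra.
  have [i [y Gy E]] := Gamma_phiP Gl; move: E; rewrite phiE.
  have := hl _ Gy; rewrite -(ler_pM2l b0); have := ord_step_le i; nra.
have s1 : s = 1.
  apply/le_anti/andP; split; last first.
    by have := hs _ (Gamma_phi ord_max Gs); rewrite phiE /= mulN_step; nra.
  have [i [y Gy E]] := Gamma_phiP Gs; move: E; rewrite phiE.
  have := hs _ Gy; rewrite -(ler_pM2l b0); have := ord_step_le i; nra.
by subst s l; split => // x Gx; rewrite hl //= hs.
Qed.

Lemma Gamma0 : Gamma 0. Proof. by case: Gamma_01. Qed.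
Lemma Gamma1 : Gamma 1. Proof. by case: Gamma_01. Qed.
Lemma Gamma_itv x : Gamma x -> 0 <= x <= 1. Proof. by case: Gamma_01 => _ _; apply. Qed.

(** Replacing every digit [i] of a point of [Gamma] by [N - i] reflects it;
    truncating the expansion at length [n] costs an error [beta ^+ n], and
    [Gamma] is closed. *)
Lemma Gamma_sym x : Gamma x -> Gamma (1 - x).
Proof.
have b0 := beta_gt0.
move=> Gx; apply: compact_approx Gamma_compact _ => e e0.
suff h n : forall x, Gamma x -> exists2 y, Gamma y & `|1 - x - y| <= beta ^+ n.
  have [n hn] := expb_lt_eps e0.
  by have [y Gy hy] := h n x Gx; exists y => //; exact: le_lt_trans hy hn.
elim: n => [|n IH] {Gx}x Gx.
  exists 0; first exact: Gamma0.
  by rewrite expr0; have /Gamma_itv := Gx; rewrite ler_norml; lra.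
have [i [y Gy ->]] := Gamma_phiP Gx; have [z Gz hz] := IH _ Gy.
exists (phi beta (rev_ord i) z); first exact: Gamma_phi.
have -> : 1 - phi beta i y - phi beta (rev_ord i) z = beta * (1 - y - z).
  rewrite !phiE /= subSS natrB; last by rewrite -ltnS ltn_ord.
  by have := mulN_step; lra.
by rewrite normrM gtr0_norm // exprS ler_pM2l.
Qed.

(** * Gaps of the Cantor set *)

(** No gap of [Gamma] is longer than the first-level gaps. An interval free of
    [Gamma] avoids the endpoints of the first-level pieces, so it lies inside a
    first-level gap or inside the hull of one piece; in the second case the
    inverse of that piece's map makes it [beta ^- 1] times longer, which can
    happen only finitely often inside the unit interval. *)
Lemma Gamma_gap (x h : R) : c - beta < h -> 0 <= x -> x + h <= 1 ->
  exists2 y, Gamma y & x < y < x + h.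
Proof.
have b0 := beta_gt0; have bc := beta_lt_step.
move=> hh; have h0 : 0 < h by lra.
have [n hn] := expb_lt_eps h0.
elim: n x h hn hh h0 => [|n IH] x h hn hh h0 x0 x1; first by rewrite expr0 in hn; lra.
(* [i] will be the last first-level piece that starts at or before [x]. *)
have P0 : ((ord0 : 'I_N.+1)%:R * c <= x) by rewrite mul0r.
case: (@arg_maxnP _ ord0 (fun i : 'I_N.+1 => i%:R * c <= x) (fun i => nat_of_ord i) P0).
move=> i hi imax.
have [xend|xend] := ltP x (i%:R * c + beta); last first.
  have iN : (i < N)%N.
    rewrite ltn_neqAle -ltnS ltn_ord andbT; apply/eqP => E; move: xend.
    by rewrite E mulN_step; lra.
  have iN' : (i.+1 < N.+1)%N by [].
  exists (phi beta (Ordinal iN') 0); first exact/Gamma_phi/Gamma0.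
  rewrite phiE /= mulr0 add0r; apply/andP; split.
    rewrite ltNge; apply/negP => hj.
    by have := imax (Ordinal iN') hj; rewrite /= ltnn.
  by rewrite -natr1; lra.
have [xh|xh] := ltP (i%:R * c + beta) (x + h).
  exists (phi beta i 1); first exact/Gamma_phi/Gamma1.
  by rewrite phiE mulr1; lra.
have [| | | | |y Gy hy] := IH ((x - i%:R * c) / beta) (h / beta).
- by rewrite ltr_pdivlMr // mulrC -exprS.
- by apply: lt_le_trans hh _; rewrite ler_pdivlMr //; have := beta_lt1; nra.
- by rewrite divr_gt0.
- by rewrite divr_ge0 ?subr_ge0 // ltW.
- by rewrite -mulrDl ler_pdivrMr //; lra.
exists (phi beta i y); first exact: Gamma_phi.
move: hy; rewrite -mulrDl ltr_pdivrMr // ltr_pdivlMr // phiE; lra.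
Qed.

(** The copy [beta ^+ K.+1 * Gamma] ends at [beta ^+ K.+1], strictly before
    [beta ^+ K * c], so it is separated from the rest of [Gamma]. *)
Lemma Gamma_near0 (K : nat) (x : R) : Gamma x -> x < beta ^+ K * c ->
  exists2 y, Gamma y & x = beta ^+ K.+1 * y.
Proof.
have b0 := beta_gt0.
have near0 z : Gamma z -> z < c -> exists2 y, Gamma y & z = beta * y.
  move=> Gz zc; have [i [y Gy E]] := Gamma_phiP Gz.
  exists y => //; move: E zc; rewrite phiE => ->.
  have /andP[y0 _] := Gamma_itv Gy.
  case: (posnP i) => [->|i0]; first by rewrite mul0r addr0.
  have ci : c <= i%:R * c by rewrite ler_peMl ?(ltW step_gt0) // ler1n.
  have by0 : 0 <= beta * y by rewrite mulr_ge0 // ltW.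
  by rewrite ltNge (le_trans ci) // lerDr.
elim: K x => [|K IH] x Gx.
  by rewrite expr0 mul1r expr1; apply: near0.
move=> xK; have [|y Gy E] := near0 x Gx.
  apply: lt_le_trans xK _; rewrite ler_piMl ?(ltW step_gt0) //.
  by rewrite exprn_ile1 ?ltW // beta_lt1.
have [|z Gz Ez] := IH y Gy.
  by rewrite -(ltr_pM2l b0) -E mulrA -exprS.
by exists z; rewrite // E Ez [in RHS]exprS mulrA.
Qed.

(** * Affine maps of the Cantor set into itself *)

Lemma Gamma_off_gap (i : nat) (y : R) :
  Gamma y -> i%:R * c + beta < y -> i.+1%:R * c <= y.
Proof.
move=> /Gamma_phiP[k [z /Gamma_itv/andP[z0 z1] ->]]; rewrite phiE => h.
have bz0 : 0 <= beta * z by rewrite mulr_ge0 // ltW // beta_gt0.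
have bz1 : beta * z <= beta by rewrite ler_piMr // ltW // beta_gt0.
have : (i < k)%N.
  rewrite ltnNge; apply/negP.
  by rewrite -(ler_nat R) -(ler_pM2r step_gt0); move: bz1 h; lra.
by rewrite -(ler_nat R) -(ler_pM2r step_gt0); move: bz0; lra.
Qed.

(** The preimage under the map of the gap following piece [i] has length
    [(c - beta) / `|l|], lies between [p] and [q], and would be free of
    points of [Gamma], against [Gamma_gap]. *)
Lemma no_straddle (l a p q : R) (i j : 'I_N.+1) : l != 0 -> `|l| < 1 ->
  (forall x, Gamma x -> Gamma (l * x + a)) -> Gamma p -> Gamma q ->
  l * p + a <= i%:R * c + beta -> j%:R * c <= l * q + a -> ~ (i < j)%N.
Proof.
move=> l0 l1 hG Gp Gq hp hq ij.
have bc := beta_lt_step.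
have {}hq : i.+1%:R * c <= l * q + a.
  by apply: le_trans hq; rewrite ler_pM2r ?step_gt0 // ler_nat.
have off y : Gamma y -> l * y + a <= i%:R * c + beta \/ i.+1%:R * c <= l * y + a.
  move=> Gy; have [h|h] := leP (l * y + a) (i%:R * c + beta); first by left.
  by right; apply: Gamma_off_gap h; apply: hG.
have /andP[p0 p1] := Gamma_itv Gp; have /andP[q0 q1] := Gamma_itv Gq.
(* [u] and [v] are the preimages of the two ends of the gap. *)
pose u := (i%:R * c + beta - a) / l; pose v := (i.+1%:R * c - a) / l.
have lu : l * u = i%:R * c + beta - a by rewrite mulrC divfK.
have lv : l * v = i.+1%:R * c - a by rewrite mulrC divfK.
have luv : l * (v - u) = c - beta by rewrite mulrBr lu lv -natr1; ring.
clearbody u v.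
have [lneg|lpos] := ltP l 0.
  rewrite ltr0_norm // in l1.
  have nl : 0 < - l by rewrite oppr_gt0.
  have qv : q <= v by rewrite -(ler_nM2l lneg) lv; move: hq; lra.
  have up : u <= p by rewrite -(ler_nM2l lneg) lu; move: hp; lra.
  have duv : - l * (u - v) = c - beta by rewrite -luv; ring.
  have d0 : 0 < u - v by rewrite -(pmulr_rgt0 _ nl) duv subr_gt0.
  have [| | |y Gy /andP[y1 y2]] := @Gamma_gap v (u - v).
  - by rewrite -duv gtr_pMl.
  - exact: le_trans qv.
  - by rewrite subrKC (le_trans up).
  move: y1 y2; rewrite -(ltr_nM2l lneg) subrKC -[y < u](ltr_nM2l lneg) lu lv.
  by move=> y1 y2; case: (off y Gy); move: y1 y2; lra.
have {l0}lpos : 0 < l by rewrite lt_neqAle eq_sym l0.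
rewrite gtr0_norm // in l1.
have qv : v <= q by rewrite -(ler_pM2l lpos) lv; move: hq; lra.
have up : p <= u by rewrite -(ler_pM2l lpos) lu; move: hp; lra.
have d0 : 0 < v - u by rewrite -(pmulr_rgt0 _ lpos) luv subr_gt0.
have [| | |y Gy /andP[y1 y2]] := @Gamma_gap u (v - u).
- by rewrite -luv gtr_pMl.
- exact: le_trans up.
- by rewrite subrKC (le_trans qv).
move: y1 y2; rewrite -(ltr_pM2l lpos) subrKC -[y < v](ltr_pM2l lpos) lu lv.
by move=> y1 y2; case: (off y Gy); move: y1 y2; lra.
Qed.

(** The piece is the one containing the image of 0. *)
Lemma image_in_piece (l a : R) : l != 0 -> `|l| < 1 ->
  (forall x, Gamma x -> Gamma (l * x + a)) ->
  exists i : 'I_N.+1,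
    forall x, Gamma x -> exists2 y, Gamma y & l * x + a = phi beta i y.
Proof.
move=> l0 l1 hG.
have piece x : Gamma x -> exists2 i : 'I_N.+1,
    (exists2 y, Gamma y & l * x + a = phi beta i y) &
    i%:R * c <= l * x + a <= i%:R * c + beta.
  move=> /hG/Gamma_phiP[i [y Gy ->]]; exists i; first by exists y.
  have /andP[y0 y1] := Gamma_itv Gy.
  rewrite phiE lerDr mulr_ge0 ?(ltW beta_gt0) //= addrC lerD2l.
  by rewrite ler_piMr // ltW // beta_gt0.
have [i _ /andP[i1 i2]] := piece _ Gamma0; exists i => x Gx.
have [j hj /andP[j1 j2]] := piece _ Gx.
suff -> : i = j by [].
have ij := no_straddle l0 l1 hG Gamma0 Gx i2 j1.
have ji := no_straddle l0 l1 hG Gx Gamma0 j2 i1.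
by case: (ltngtP i j) => [/ij|/ji|/val_inj].
Qed.

Lemma rigidity_base (l a : R) : 1 <= `|l| ->
  (forall x, Gamma x -> Gamma (l * x + a)) ->
  (l = 1 /\ a = 0) \/ (l = -1 /\ a = 1).
Proof.
move=> l1 hG.
have := Gamma_itv (hG _ Gamma0); have := Gamma_itv (hG _ Gamma1).
rewrite mulr0 mulr1 add0r => h1 h0.
have [lneg|lpos] := ltP l 0.
  by right; rewrite ltr0_norm // in l1; split; lra.
by left; rewrite ger0_norm // in l1; split; lra.
Qed.

(** Induction on an [n] with [beta ^+ n <= `|l|]: while [`|l| < 1], the
    image lies in one piece, and the inverse of that piece's map turns [l] into
    [l / beta]. The two cases are [phi_word w] and [phi_word w (1 - _)]. *)
Lemma rigidity (l a : R) : l != 0 ->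
  (forall x, Gamma x -> Gamma (l * x + a)) ->
  exists w : seq 'I_N.+1,
    (l = beta ^+ size w /\ a = phi_word beta w 0) \/
    (l = - beta ^+ size w /\ a = phi_word beta w 1).
Proof.
move=> l0; have b0 := beta_gt0; have bn0 := lt0r_neq0 b0.
have [|n /ltW hn] := @expb_lt_eps `|l|; first by rewrite normr_gt0.
elim: n l a hn l0 => [|n IH] l a hn l0 hG.
  by exists [::]; apply: rigidity_base.
have [l1|l1] := ltP `|l| 1; last by exists [::]; apply: rigidity_base.
have [i hi] := image_in_piece l0 l1 hG.
have El : l = beta * (l / beta) by rewrite mulrC divfK.
have Ea : a = beta * ((a - i%:R * c) / beta) + i%:R * c.
  by rewrite [beta * _]mulrC divfK ?subrK.
have [||x Gx|w hw] := IH (l / beta) ((a - i%:R * c) / beta).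
- by rewrite normrM normfV (gtr0_norm b0) ler_pdivlMr // mulrC -exprS.
- by rewrite mulf_neq0 // invr_eq0.
- have [y Gy E] := hi x Gx.
  suff -> : (l / beta) * x + (a - i%:R * c) / beta = y by [].
  apply: (mulfI bn0); move: E; rewrite phiE {1}El {1}Ea addrA => /addIr <-.
  by rewrite mulrDr (mulrA beta (l / beta)).
exists (i :: w) => /=; rewrite exprS !phiE El Ea.
by case: hw => -[-> ->]; [left|right; rewrite mulrN].
Qed.

(** By rigidity the map is some [phi_word u]; comparing the ratios, [u] has the
    same length as [w], and [phi_word u 0] is the value at 0. *)
Lemma word_translate_E (w : seq 'I_N.+1) (s : R) :
  (forall x, Gamma x -> Gamma (phi_word beta w (x + s))) ->
  E_ N beta (size w) (phi_word beta w s).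
Proof.
move=> h; have bw := expb_gt0 (size w).
have [||u [[Ebw ->]|[Ebw _]]] := @rigidity (beta ^+ size w) (phi_word beta w s).
- exact: lt0r_neq0.
- move=> x /h; congr (Gamma _).
  by rewrite phi_wordE [in RHS]phi_wordE; ring.
- exists u => //; rewrite /words /=; apply/esym; move: Ebw; apply: ieexprIn.
    exact: beta_gt0.
  by rewrite lt_eqF // beta_lt1.
have := expb_gt0 (size u); move: bw Ebw; lra.
Qed.

(** * Unions of translates *)

Section Translates.
Variables (m : nat).
Implicit Type t : 'I_m.+1 -> R.
Local Notation Gt t := (union_translates Gamma t).

Lemma translation_ge0 t j : translation_vector t -> 0 <= t j.
Proof.
move=> [t0 ht]; case: (posnP j) => [j0|j0].
  by rewrite -t0 le_eqVlt; apply/orP; left; apply/eqP; congr t; apply: val_inj.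
by rewrite -t0 ltW // ht.
Qed.

Lemma translation_le_max t j : translation_vector t -> t j <= t ord_max.
Proof.
move=> [_ ht]; have : (j <= m)%N by rewrite -ltnS.
rewrite leq_eqVlt => /orP[/eqP jm|jm]; last by rewrite ltW // ht.
by rewrite le_eqVlt; apply/orP; left; apply/eqP; congr t; apply: val_inj.
Qed.

Lemma union_translatesP t z :
  Gt t z <-> exists j, exists2 x, Gamma x & z = x + t j.
Proof.
split; first by move=> [j _ [x Gx <-]]; exists j, x.
by move=> [j [x Gx ->]]; exists j => //; exists x.
Qed.

Lemma union_translates_itv t z : translation_vector t -> Gt t z ->
  0 <= z <= 1 + t ord_max.
Proof.
move=> ht /union_translatesP[j [x /Gamma_itv/andP[x0 x1] ->]].
apply/andP; split; first by rewrite addr_ge0 // translation_ge0.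
by apply: lerD => //; exact: translation_le_max.
Qed.

Lemma Gamma_sub_union t : translation_vector t -> Gamma `<=` Gt t.
Proof.
move=> [t0 _] x Gx; apply/union_translatesP; exists ord0, x => //.
by rewrite t0 addr0.
Qed.

(** Every translate but the one by [t 0 = 0] starts at [t 1] or later. *)
Lemma union_near0 t : translation_vector t ->
  exists2 e, 0 < e & forall z, Gt t z -> z < e -> Gamma z.
Proof.
move=> [t0 ht]; case: (posnP m) => [m0|m0].
  exists 1 => // z /union_translatesP[j [x Gx ->]] _.
  have : (j <= m)%N by rewrite -ltnS.
  rewrite [X in (_ <= X)%N]m0 leqn0 => /eqP j0.
  have -> : j = ord0 by apply: val_inj.
  by rewrite t0 addr0.
have m1 : (1 < m.+1)%N by [].
exists (t (Ordinal m1)); first by rewrite -t0 ht.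
move=> z /union_translatesP[j [x Gx ->]]; have /andP[x0 _] := Gamma_itv Gx.
case: (posnP j) => [j0 _|j0 h].
  by have -> : j = ord0 by [apply: val_inj]; rewrite t0 addr0.
have : t (Ordinal m1) <= t j.
  move: j0; rewrite leq_eqVlt => /orP[/eqP j1|j1]; last by rewrite ltW // ht.
  by rewrite le_eqVlt; apply/orP; left; apply/eqP; congr t; apply: val_inj.
by move=> h'; move: (lt_le_trans h h'); rewrite ltNge lerDr x0.
Qed.

(** Pieces of [Gt] that meet [beta ^+ K.+1 * Gamma] stay in it when they are
    shorter than the separating gap, and those pieces, enlarged by the factor
    [beta ^- K.+1], cover [Gamma]. The bound on the ratios will force the words
    describing these copies to be long. *)
Lemma small_copies t (e : R) : translation_vector t -> self_similar (Gt t) ->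
  0 < e -> exists Q : seq (R * R),
  (forall q, q \in Q -> 0 < `|q.1| < e /\ forall z, Gt t z -> Gamma (simil q z)) /\
  (forall x, Gamma x -> exists2 q, q \in Q & exists2 z, Gt t z & x = simil q z).
Proof.
move=> ht [[F [hF attrF]] _] e0; have b0 := beta_gt0.
have [d d0 hd] := union_near0 ht.
have [K hK] := expb_lt_eps d0.
have K0 := expb_gt0 K; have K1 := expb_gt0 K.+1.
(* [D] bounds the diameter of [Gt]; [e'] makes a piece shorter than the gap
   that follows [beta ^+ K.+1 * Gamma], and of ratio below [e] once enlarged. *)
pose D := 1 + t ord_max.
have D0 : 0 < D by rewrite ltr_wpDr ?translation_ge0.
have gap0 : 0 < beta ^+ K * (c - beta) / D.
  by rewrite divr_gt0 // mulr_gt0 // subr_gt0 beta_lt_step.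
pose e' := Num.min (e * beta ^+ K.+1) (beta ^+ K * (c - beta) / D).
have [|P [hP EP]] := @fine_pieces _ F (Gt t) e' hF attrF.
  by rewrite lt_min gap0 andbT mulr_gt0.
pose b := beta ^+ K.+1.
pose good p := `[< forall z, Gt t z -> exists2 y, Gamma y & simil p z = b * y >].
pose resc (p : R * R) := (p.1 / b, p.2 / b).
have rescE p x : simil (resc p) x = simil p x / b.
  by rewrite /simil /= mulrDl mulrAC.
exists [seq resc p | p <- P & good p]; split.
  move=> q /mapP[p]; rewrite mem_filter => /andP[/asboolP gp pP] ->.
  have /andP[p0 pe] := hP p pP; split.
    rewrite /= normrM normfV (gtr0_norm K1) divr_gt0 //= ltr_pdivrMr //.
    by apply: lt_le_trans pe _; rewrite ge_min lexx.
  move=> z /gp[y Gy E]; rewrite rescE E mulrC mulKf //.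
  exact: lt0r_neq0.
move=> x Gx; have /andP[x0 x1] := Gamma_itv Gx.
have : Gt t (b * x).
  by apply: Gamma_sub_union => //; apply: Gamma_scale.
rewrite {1}EP => -[p pP [z Gz Ez]].
have /andP[p0 pe] := hP p pP.
have gp : good p.
  apply/asboolP => z' Gz'.
  have dz : `|z' - z| <= D.
    have := union_translates_itv ht Gz; have := union_translates_itv ht Gz'.
    by rewrite ler_norml -/D; lra.
  have hz' : simil p z' < beta ^+ K * c.
    have -> : simil p z' = b * x + p.1 * (z' - z).
      by rewrite -Ez /simil; ring.
    have bx : b * x <= beta ^+ K * beta by rewrite /b exprSr ler_piMr // ltW // mulr_gt0.
    have h1 : p.1 * (z' - z) <= `|p.1| * D.
      by apply: le_trans (ler_norm _) _; rewrite normrM ler_pM.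
    have h2 : `|p.1| * D < beta ^+ K * (c - beta).
      by rewrite -ltr_pdivlMr //; apply: lt_le_trans pe _; rewrite ge_min lexx orbT.
    move: bx h1 h2; rewrite mulrBr; lra.
  have [|y Gy E] := @Gamma_near0 K (simil p z') _ hz'; last by exists y.
  apply: hd; last first.
    apply: lt_trans hz' _; apply: le_lt_trans hK.
    by rewrite ler_piMr ?ltW // step_lt1.
  by rewrite EP; exists p => //; exists z'.
exists (resc p); first by apply: map_f; rewrite mem_filter gp.
exists z => //; rewrite rescE Ez mulrC mulKf //; exact: lt0r_neq0.
Qed.

(** The index [j = 0], which the definition of [Omega_t] leaves out, always
    satisfies the condition because [t 0 = 0]. *)
Lemma Omega_tP t n (w : seq 'I_N.+1) : translation_vector t ->
  Omega_t beta t n w <->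
  size w = n /\ forall j, E_ N beta n (phi_word beta w (t j)).
Proof.
move=> [t0 _]; split=> -[hw h]; split=> // j.
case: (posnP j) => [j0|]; last exact: h.
have -> : j = ord0 by apply: val_inj.
by rewrite t0; exists w.
Qed.

Lemma Omega_hat_tP t n (w : seq 'I_N.+1) : translation_vector t ->
  Omega_hat_t beta t n w <->
  size w = n /\ forall j, E_ N beta n (phi_word beta w (- t j)).
Proof.
move=> [t0 _]; split=> -[hw h]; split=> // j.
case: (posnP j) => [j0|]; last exact: h.
have -> : j = ord0 by apply: val_inj.
by rewrite t0 oppr0; exists w.
Qed.

Definition direct_copy t q (w : seq 'I_N.+1) : Prop :=
  Omega_t beta t (size w) w /\ forall z, simil q z = phi_word beta w z.

Definition reflected_copy t q (w : seq 'I_N.+1) : Prop :=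
  Omega_hat_t beta t (size w) w /\
  forall z, simil q z = phi_word beta w (1 - z).

(** Rigidity on the translate by [t 0 = 0] yields [w]. On the translate by
    [t j] it gives the membership in [E_]; in the reflected case one uses
    [1 - ((1 - x) + t j) = x - t j]. *)
Lemma copy_is_word t q : translation_vector t -> q.1 != 0 ->
  (forall z, Gt t z -> Gamma (simil q z)) ->
  exists w : seq 'I_N.+1, `|q.1| = beta ^+ size w /\
    (direct_copy t q w \/ reflected_copy t q w).
Proof.
move=> ht q0 hq.
have [x Gx|w hw] := @rigidity q.1 q.2 q0.
  by apply: hq; apply: Gamma_sub_union.
exists w; have b0 := expb_gt0 (size w).
case: hw => -[E1 E2]; (split; first by rewrite E1 ?normrN gtr0_norm).
  left; have E z : simil q z = phi_word beta w z.
    by rewrite /simil E1 E2 [in RHS]phi_wordE.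
  split=> //; apply/(Omega_tP _ _ ht); split=> // j.
  apply: word_translate_E => x Gx; rewrite -E; apply: hq.
  by apply/union_translatesP; exists j, x.
right; have E z : simil q z = phi_word beta w (1 - z).
  by rewrite /simil E1 E2 phi_wordE [in RHS]phi_wordE; ring.
split=> //; apply/(Omega_hat_tP _ _ ht); split=> // j.
apply: word_translate_E => x Gx.
have -> : x - t j = 1 - (1 - x + t j) by ring.
rewrite -E; apply: hq; apply/union_translatesP; exists j, (1 - x) => //.
exact: Gamma_sym.
Qed.

Definition word_cover t (I1 I2 : set (seq 'I_N.+1)) : Prop :=
  \bigcup_(w in I1) (phi_word beta w @` Gt t) `|`
  \bigcup_(w in I2) (phi_word beta w @` [set 1 - x | x in Gt t]) = Gamma.

(** A copy of ratio below [beta ^+ n0] is given by a word longer than [n0]. *)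
Lemma self_similar_word_cover t (n0 : nat) :
  translation_vector t -> self_similar (Gt t) ->
  exists I1 I2, [/\ finite_set I1, finite_set I2,
    I1 `<=` \bigcup_(n in [set n | (n0 <= n)%N]) Omega_t beta t n,
    I2 `<=` \bigcup_(n in [set n | (n0 <= n)%N]) Omega_hat_t beta t n &
    word_cover t I1 I2].
Proof.
move=> ht ss; have [Q [hQ cQ]] := small_copies ht ss (expb_gt0 n0).
have /choice[f hf] : forall q, exists w : seq 'I_N.+1, q \in Q ->
    `|q.1| = beta ^+ size w /\
    (direct_copy t q w \/ reflected_copy t q w).
  move=> q; have [qQ|] := boolP (q \in Q); last by exists [::].
  have [/andP[q0 _] hq] := hQ q qQ.
  have [|w hw] := copy_is_word ht _ hq; first by rewrite -normr_gt0.
  by exists w.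
have long q : q \in Q -> (n0 <= size (f q))%N.
  move=> qQ; have [/andP[_ q1] _] := hQ q qQ; have [E _] := hf q qQ.
  move: q1; rewrite E ltr_iXn2l ?beta_gt0 ?beta_lt1 //; exact: ltnW.
exists [set f q | q in [set q | q \in Q /\ direct_copy t q (f q)]].
exists [set f q | q in [set q | q \in Q /\ reflected_copy t q (f q)]].
split.
- by apply: finite_image; apply: sub_finite_set (finite_seq Q) => q [].
- by apply: finite_image; apply: sub_finite_set (finite_seq Q) => q [].
- by move=> w0 [q [qQ [om _]] <-]; exists (size (f q)) => //; exact: long.
- by move=> w0 [q [qQ [om _]] <-]; exists (size (f q)) => //; exact: long.
apply/seteqP; split => x.
  move=> [] [_ [q [qQ [om E] ] <-] [z]].
    by move=> Gz <-; rewrite -E; apply: (hQ q qQ).2.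
  by move=> [z' Gz' <-] <-; rewrite -E; apply: (hQ q qQ).2.
move=> /cQ[q qQ [z Gz ->]].
have [_ [[om E]|[om E]]] := hf q qQ; [left|right]; exists (f q).
- by exists q.
- by rewrite E; exists z.
- by exists q.
by rewrite E; exists (1 - z) => //; exists z.
Qed.

Lemma T_of_fixed0 n (w : seq 'I_N.+1) s :
  (1 <= n)%N -> size w = n -> phi_word beta w 0 = 0 :> R ->
  E_ N beta n (phi_word beta w s) -> T N beta s.
Proof.
move=> n1 sw w0 h; exists n => //; exists (phi_word beta w s) => //.
by rewrite phi_wordE w0 addr0 sw mulrA mulVf ?mul1r // lt0r_neq0 // expb_gt0.
Qed.

(** Look at the member of the cover containing 0. The points [phi_word w 0]
    and [phi_word w (- t ord_max)], images of the least points of [Gt] and of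
    [1 - Gt], are in [E_] and so nonnegative; hence the one concerned is 0. In
    the first case [phi_word w 0 = 0]. In the second
    [phi_word w (- t ord_max) = 0], and the differences [t ord_max - t j],
    scaled by [beta ^+ n], are the values [phi_word w (- t j)]. *)
Lemma word_cover_T t I1 I2 : translation_vector t ->
  I1 `<=` \bigcup_(n in [set n | (1 <= n)%N]) Omega_t beta t n ->
  I2 `<=` \bigcup_(n in [set n | (1 <= n)%N]) Omega_hat_t beta t n ->
  word_cover t I1 I2 ->
  (forall j, T N beta (t j)) \/ (forall j, T N beta (conjugate t j)).
Proof.
move=> ht h1 h2 cov; have : Gamma 0 := Gamma0.
have E0 n x : E_ N beta n x -> 0 <= x.
  move=> [w _ <-]; have /andP[]// := Gamma_itv (Gamma_phi_word w Gamma0).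
rewrite -cov => -[] [w wI [z]].
  move=> Gz E; left => j; have [n /= n1 /(Omega_tP _ _ ht)[sw hw]] := h1 _ wI.
  apply: T_of_fixed0 n1 sw _ (hw j); apply/le_anti/andP; split; last first.
    by have /andP[] := Gamma_itv (Gamma_phi_word w Gamma0).
  have /andP[z0 _] := union_translates_itv ht Gz.
  by rewrite -[leRHS]E [leRHS]phi_wordE lerDr mulr_ge0 // ltW // expb_gt0.
move=> [x Gx <-] E; right => j.
have [n /= n1 /(Omega_hat_tP _ _ ht)[sw hw]] := h2 _ wI.
have bn := expb_gt0 n.
have wmax : phi_word beta w (- t ord_max) = 0.
  apply/le_anti/andP; split; last exact: E0 (hw _).
  have /andP[_ x1] := union_translates_itv ht Gx.
  rewrite -[leRHS]E phi_wordE [leRHS]phi_wordE lerD2r ler_pM2l ?expb_gt0 //.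
  by move: x1; lra.
have := hw (rev_ord j); rewrite phi_wordE.
move: wmax; rewrite phi_wordE sw => wmax hj.
exists n => //; exists (beta ^+ n * conjugate t j); last first.
  by rewrite mulKf // lt0r_neq0.
suff <- : beta ^+ n * - t (rev_ord j) + phi_word beta w 0 =
          beta ^+ n * conjugate t j by [].
by rewrite /conjugate; move: wmax; lra.
Qed.

Lemma conjugateK t : translation_vector t -> conjugate (conjugate t) = t.
Proof.
move=> [t0 _]; apply/funext => j; rewrite /conjugate rev_ordK.
have -> : rev_ord ord_max = ord0 :> 'I_m.+1 by apply: val_inj; rewrite /= subnn.
by rewrite t0 subr0 subKr.
Qed.

Lemma conjugate_translation t :
  translation_vector t -> translation_vector (conjugate t).
Proof.
move=> [t0 ht]; rewrite /conjugate; split.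
  have -> : rev_ord ord0 = ord_max :> 'I_m.+1 by apply: val_inj; rewrite /= subn1.
  by rewrite subrr.
move=> i j ij; rewrite ltrD2l ltrN2; apply: ht.
by rewrite /= !subSS ltn_sub2l // (leq_trans ij) // -ltnS.
Qed.

Lemma union_conjugate t :
  Gt (conjugate t) = [set 1 + t ord_max - x | x in Gt t].
Proof.
apply/seteqP; split => z.
  move=> /union_translatesP[j [x Gx ->]].
  exists (1 - x + t (rev_ord j)); last by rewrite /conjugate; ring.
  by apply/union_translatesP; exists (rev_ord j), (1 - x) => //; exact: Gamma_sym.
move=> [_ /union_translatesP[j [x Gx ->]] <-].
apply/union_translatesP; exists (rev_ord j), (1 - x); first exact: Gamma_sym.
by rewrite /conjugate rev_ordK; ring.
Qed.

Lemma self_similar_conjugate t :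
  self_similar (Gt t) -> self_similar (Gt (conjugate t)).
Proof. by rewrite union_conjugate; exact: self_similar_reflect. Qed.

Lemma self_similar_dichotomy t : translation_vector t -> self_similar (Gt t) ->
  (forall j, T N beta (t j)) \/ (forall j, T N beta (conjugate t j)).
Proof.
move=> ht ss; have [I1 [I2 [_ _ h1 h2 cov]]] := self_similar_word_cover 1 ht ss.
exact: word_cover_T ht h1 h2 cov.
Qed.

(** Asking for words of length at least [tau] is harmless, since
    [self_similar_word_cover] provides words as long as desired. *)
Lemma self_similar_admissible t : translation_vector t ->
  self_similar (Gt t) -> (forall j, T N beta (t j)) -> admissible N beta Gamma t.
Proof.
move=> ht ss hT; split=> //; exact: self_similar_word_cover.
Qed.

Lemma E_shift n x : E_ N beta n x -> E_ N beta n.+1 (beta * x).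
Proof.
move=> [w sw <-]; exists (ord0 :: w); first by rewrite /words /= sw.
by rewrite /= phiE mul0r addr0.
Qed.

Lemma T_level_mono n k x : (n <= k)%N -> T_ N beta n x -> T_ N beta k x.
Proof.
move=> /subnK <-; elim: (k - n)%N => [//|d IH] /IH[y Ey <-].
rewrite addSn; exists (beta * y); first exact: E_shift.
have bn := lt0r_neq0 beta_gt0.
by rewrite exprS invfM mulrACA [_^-1 * beta]mulrC; field; rewrite expf_neq0.
Qed.

(** The levels [T_ n] increase, so finitely many elements of [T] lie in a
    common level and the default value 0 of [tau] is not taken. Hence the words
    of an admissible cover are nonempty and their maps contract. *)
Lemma tau_gt0 t : (forall j, T N beta (t j)) -> (1 <= tau N beta t)%N.
Proof.
move=> hT; have [n hn] : exists n, in_T_level N beta t n.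
  have /choice[f hf] : forall j, exists n, (1 <= n)%N /\ T_ N beta n (t j).
    by move=> j; have [n n1 hn] := hT j; exists n.
  exists (\max_j f j); split.
    by apply: leq_trans (leq_bigmax ord0); case: (hf ord0).
  by move=> j _; apply: T_level_mono (hf j).2; exact: leq_bigmax.
have exP : exists n, `[< in_T_level N beta t n >] by exists n; apply/asboolP.
have [k /asboolP hk kmin] := ex_minnP exP.
rewrite /tau; case: xgetP => [k' _ [[] //]|/(_ k)[]].
by split=> // l /asboolP; apply: kmin.
Qed.

(** Each translate [Gamma + t j] is covered by the translates by [t j] of the
    copies [phi_word w Gt] and [phi_word w (1 - Gt)] that cover [Gamma]. *)
Lemma admissible_self_similar t : (1 <= m)%N ->
  admissible N beta Gamma t -> self_similar (Gt t).
Proof.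
move=> m1 [ht hT [I1 [I2 [fI1 fI2 h1 h2 cov]]]].
have tau1 := tau_gt0 hT; have b0 := beta_gt0.
split; last first.
  move=> [x E]; have m1' : (1 < m.+1)%N by [].
  have tpos : 0 < t (Ordinal m1') by case: ht => <- ht; apply: ht.
  have : Gt t 0 by apply: Gamma_sub_union => //; exact: Gamma0.
  have : Gt t (t (Ordinal m1')).
    apply/union_translatesP; exists (Ordinal m1'), 0; rewrite ?add0r //.
    exact: Gamma0.
  by rewrite E => /= tx x0; rewrite tx -x0 ltxx in tpos.
have [s1 Es1] := (finite_seqP _).1 fI1; have [s2 Es2] := (finite_seqP _).1 fI2.
(* The coefficients of [phi_word w x + t j] and [phi_word w (1 - x) + t j]. *)
pose p1 (w : seq 'I_N.+1) (j : 'I_m.+1) := (beta ^+ size w, phi_word beta w 0 + t j).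
pose p2 (w : seq 'I_N.+1) (j : 'I_m.+1) := (- beta ^+ size w, phi_word beta w 1 + t j).
have p1E w j x : simil (p1 w j) x = phi_word beta w x + t j.
  by rewrite /simil /= [in RHS]phi_wordE addrA.
have p2E w j x : simil (p2 w j) x = phi_word beta w (1 - x) + t j.
  by rewrite /simil /= phi_wordE [in RHS]phi_wordE; ring.
exists ([seq p1 w j | w <- s1, j <- enum 'I_m.+1] ++
        [seq p2 w j | w <- s2, j <- enum 'I_m.+1]); split.
  have ratio (w : seq 'I_N.+1) : (tau N beta t <= size w)%N -> 0 < `|beta ^+ size w| < 1.
    move=> sw; rewrite gtr0_norm ?expb_gt0 //= exprn_ilt1 ?ltW ?beta_lt1 //.
    by rewrite -lt0n (leq_trans tau1).
  move=> q; rewrite mem_cat => /orP[] /allpairsP[[w j] /= [ws _ ->]] /=.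
    have /h1[n /= tn [sw _]] : I1 w by rewrite Es1.
    by apply: ratio; rewrite (sw : size w = n).
  have /h2[n /= tn [sw _]] : I2 w by rewrite Es2.
  by rewrite normrN; apply: ratio; rewrite (sw : size w = n).
split.
- by exists 0; apply: Gamma_sub_union => //; exact: Gamma0.
- suff -> : Gt t = \big[setU/set0]_(j <- enum 'I_m.+1) (simil (1, t j) @` Gamma).
    by apply: bigsetU_compact => j _; apply: compact_simil; exact: Gamma_compact.
  rewrite -bigcup_seq; apply/seteqP; split => x.
    move=> /union_translatesP[j [y Gy ->]]; exists j; first by rewrite /= mem_enum.
    by exists y; rewrite // /simil /= mul1r.
  move=> [j _ [y Gy <-]]; apply/union_translatesP; exists j, y => //.
  by rewrite /simil /= mul1r.
apply/seteqP; split => x.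
  move=> /union_translatesP[j [y + ->]]; rewrite -{1}cov => -[] [w wI [z]].
    move=> Gz <-; exists (p1 w j); last by exists z; rewrite ?p1E.
    rewrite /= mem_cat; apply/orP; left; apply/allpairsP; exists (w, j).
    by split; rewrite ?mem_enum //; move: wI; rewrite Es1.
  move=> [z' Gz' <-] <-; exists (p2 w j); last by exists z'; rewrite ?p2E.
  rewrite /= mem_cat; apply/orP; right; apply/allpairsP; exists (w, j).
  by split; rewrite ?mem_enum //; move: wI; rewrite Es2.
move=> [q /=]; rewrite mem_cat => /orP[] /allpairsP[[w j] /= [ws _ ->]] [z Gz <-].
  rewrite p1E; apply/union_translatesP; exists j, (phi_word beta w z) => //.
  by rewrite -cov; left; exists w; [rewrite Es1|exists z].
rewrite p2E; apply/union_translatesP; exists j, (phi_word beta w (1 - z)) => //.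
by rewrite -cov; right; exists w; [rewrite Es2|exists (1 - z) => //; exists z].
Qed.

End Translates.

End CantorSet.

Theorem theorem1p2 (R : realType) (N : nat) (beta : R) (Gamma : set R)
    (m : nat) (t : 'I_m.+1 -> R)
    (hN : (1 <= N)%N)
    (hbeta : 0 < beta < 1 / N.+1%:R)
    (hGamma : is_attractor (cantor_ifs N beta) Gamma)
    (hm : (1 <= m)%N)
    (ht : translation_vector t) :
  self_similar (union_translates Gamma t) <->
  (admissible N beta Gamma t \/ admissible N beta Gamma (conjugate t)).
Proof.
have htc := conjugate_translation ht.
have ssI s := admissible_self_similar hN hbeta hGamma (t := s) hm.
have ssJ := self_similar_conjugate hN hbeta hGamma.
split=> [ss|[|/ssI/ssJ]]; first last.
- by rewrite conjugateK.
- exact: ssI.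
have admI s := self_similar_admissible hN hbeta hGamma (t := s).
have ssc := ssJ _ _ ss.
have [tT|cT] := self_similar_dichotomy hN hbeta hGamma ht ss.
  by left; apply: admI.
by right; apply: admI.
Qed.
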